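(* Let $(X_p)_{p\in\mathcal P}$ be independent symmetric non-constant real random variables with $\sup_{p\in\mathcal P}\|X_p\|_{L^\infty}<\infty$, and let $S_n=\sum_{\ell=1}^n\theta_\ell$ be the partial sums of the associated random multiplicative function of Rademacher type. Then for every $\varepsilon>0$ there exists a random variable $B_\varepsilon\in L^{[\frac{1}{2\varepsilon}]+1}$ such that for all $n\in\mathbb N$, $$|S_n|\le B_\varepsilon\, n^{1/2+\varepsilon}\quad\text{almost surely.}$$
   Context: $\mathcal P$ is the set of prime numbers; $[x]$ denotes the integer part of $x$. The random variables $X_p$ need not be identically distributed. The random multiplicative function of Rademacher type generated by $(X_p)$ is $\theta_\ell=\prod_{p\mid \ell}X_p$ if $\ell$ is square free (so $\theta_1=1$, empty product), and $\theta_\ell=0$ otherwise. *)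

(* Defs.v *)
From HB Require Import structures.
From mathcomp Require Import all_boot all_order all_algebra.
From mathcomp Require Import finmap.
From mathcomp Require Import all_classical all_reals all_analysis.

Set Implicit Arguments.
Unset Strict Implicit.
Unset Printing Implicit Defensive.

Import Order.TTheory GRing.Theory Num.Theory.

Local Open Scope classical_set_scope.
Local Open Scope ring_scope.

(* 0 is not squarefree: every square divides it. *)
Definition squarefree (n : nat) : Prop :=
  forall k : nat, (k ^ 2 %| n)%N -> k = 1%N.

Section RandomVariables.
Context {d : measure_display} {T : measurableType d} {R : realType}.
Variable P : probability T R.

(* Only the variables [X i] with [i] in [D] are constrained. *)
Definition mutually_independent {I : choiceType} (D : set I)
    (X : I -> {RV P >-> R}) : Prop :=
  forall (J : {fset I}) (A : I -> set R),
    [set` J] `<=` D ->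
    (forall i, measurable (A i)) ->
    P (\bigcap_(i in [set` J]) (X i @^-1` A i)) =
    (\prod_(i <- J) P (X i @^-1` A i))%E.

Definition symmetric_RV (X : {RV P >-> R}) : Prop :=
  forall A : set R, measurable A ->
    pushforward P X A = pushforward P (fun w => - X w) A.

Definition constant_RV (X : {RV P >-> R}) : Prop :=
  exists c : R, {ae P, forall w, X w = c}.

(* The family is indexed by [nat], but only its values at primes are used. *)
Definition rademacher_mult (X : nat -> {RV P >-> R}) (l : nat) (w : T) : R :=
  if `[< squarefree l >] then \prod_(p <- primes l) X p w else 0.

Definition partial_sum (X : nat -> {RV P >-> R}) (n : nat) (w : T) : R :=
  \sum_(1 <= l < n.+1) rademacher_mult X l w.

End RandomVariables.

(* Main.v *)
(* For an integer k, expand the moment E[S_n^(2k)] over 2k-tuples (l_j).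
   Independence and symmetry kill every tuple unless the product of the l_j is
   a perfect square N^2, with N <= n^k. The l_j are then squarefree divisors of
   N^2, so for |X_p| <= M the tuples with given N contribute at most
   (2M)^(2k omega(N)), where omega(N) = size (primes N). As A^omega(N) grows
   slower than every power of N, E[S_n^(2k)] <= C n^(k+1). For k eps >= 2,
   B := (sum_n S_n^(2k) / n^(2k(1/2+eps)))^(1/(2k)) lies in L^(2k) and dominates
   |S_n| / n^(1/2+eps); large k gives every L^m. *)
Require Import Defs.
From HB Require Import structures.
From mathcomp Require Import all_boot all_order all_algebra.
From mathcomp Require Import finmap.
From mathcomp Require Import all_classical all_reals all_analysis.
From mathcomp Require Import measurable_realfun ess_sup_inf ring lra.

Set Implicit Arguments.
Unset Strict Implicit.
Unset Printing Implicit Defensive.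

Import Order.TTheory GRing.Theory Num.Theory.

Local Open Scope classical_set_scope.
Local Open Scope ring_scope.

(** * Squarefree numbers and the number of prime divisors *)

Section Arithmetic.
Local Open Scope nat_scope.

Lemma prod_primes_dvd n : 0 < n -> \prod_(p <- primes n) p %| n.
Proof.
move=> n0; rewrite [X in _ %| X](prod_prime_decomp n0) prime_decompE big_map /=.
rewrite big_seq [X in _ %| X]big_seq.
elim/big_ind2: _ => //; first by move=> *; apply: dvdn_mul.
move=> p; rewrite -logn_gt0 => lp; exact: dvdn_exp.
Qed.

(** A prime factor of [n] that is at least [K] absorbs one factor [K], since the product of the
    primes of [n] divides [n]. At most [K] primes lie below [K], and they cost at most [K ^ K]. *)
Lemma expn_omega_le K n : 0 < n -> K ^ size (primes n) <= K ^ K * n.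
Proof.
move=> n0; have [->|K0] := posnP K.
  by rewrite expn0 mul1n; case: (size _) => [|m]; rewrite ?expn0 ?exp0n.
have -> : K ^ size (primes n) = \prod_(p <- primes n) K.
  by rewrite big_const_seq count_predT iter_muln_1.
apply: (@leq_trans ((\prod_(p <- primes n) if p < K then K else 1) *
                    \prod_(p <- primes n) p)).
  rewrite -big_split /= big_seq [leqRHS]big_seq.
  apply: leq_prod => p; rewrite mem_primes => /andP[/prime_gt0 p0 _].
  by case: ltnP => Kp; [exact: leq_pmulr|rewrite mul1n].
rewrite leq_mul//; last exact/dvdn_leq/prod_primes_dvd.
rewrite -big_mkcond /= big_const_seq iter_muln_1 leq_pexp2l//.
rewrite -size_filter -[leqRHS](size_iota 0 K); apply: uniq_leq_size.
  exact/filter_uniq/primes_uniq.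
by move=> p; rewrite mem_filter mem_iota => /andP[].
Qed.

(** Taking [k]-th powers and using the previous bound with base [A ^ k] makes [N <= n ^ k] cost a
    single factor [n], with a constant free of [n] and [N]. *)
Lemma expn_omega_le_root A k n N : 0 < k -> 0 < N <= n ^ k ->
  A ^ size (primes N) <= (A ^ k) ^ (A ^ k) * n.
Proof.
move=> k0 /andP[N0 Nn]; rewrite -(leq_exp2r _ _ k0) expnMn -expnM mulnC expnM.
apply: leq_trans (expn_omega_le (A ^ k) N0) _.
rewrite leq_mul//; set K := (A ^ k) ^ _.
by case: K => // K; rewrite -[leqLHS]expn1 leq_pexp2l.
Qed.

Lemma squarefree_gt0 l : squarefree l -> 0 < l.
Proof. by case: l => // /(_ 2); rewrite dvdn0 => /(_ isT). Qed.

Lemma squarefree_logn l p : squarefree l -> prime p -> logn p l = (p \in primes l).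
Proof.
move=> sl pp; rewrite -logn_gt0; case E : (logn p l) => [|[|m]] //.
have : p ^ 2 %| l by rewrite pfactor_dvdn ?squarefree_gt0// E.
by move/sl => p1; rewrite p1 in pp.
Qed.

Lemma squarefree_prod_primes l : squarefree l -> l = \prod_(p <- primes l) p.
Proof.
move=> sl; have l0 := squarefree_gt0 sl.
rewrite [LHS](prod_prime_decomp l0) prime_decompE big_map /= big_seq [RHS]big_seq.
apply: eq_bigr => p pl; rewrite squarefree_logn ?pl//.
by move: pl; rewrite mem_primes => /andP[].
Qed.

(** A squarefree divisor of [N ^ 2] is determined by which primes of [N] divide it, so it injects
    into boolean tuples indexed by [primes N]. *)
Lemma card_squarefree_dvd_sqr n N : 0 < N ->
  #|[set l : 'I_n | `[<squarefree l.+1>] && (l.+1 %| N ^ 2)]%SET| <=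
  2 ^ size (primes N).
Proof.
move=> N0; rewrite -[X in _ <= X ^ _]card_bool -card_tuple.
apply: (leq_card_in (fun l : 'I_n =>
  [tuple of map (fun p => p %| l.+1) (in_tuple (primes N))])).
move=> l m; rewrite !inE => /andP[/asboolP sl lN] /andP[/asboolP sm mN] lm.
apply/ord_inj/succn_inj.
rewrite (squarefree_prod_primes sl) (squarefree_prod_primes sm).
have eqlm : {in primes N, (fun p => p %| l.+1) =1 (fun p => p %| m.+1)}.
  by apply/eq_in_map; move/(congr1 val): lm.
suff -> : primes l.+1 = primes m.+1 by [].
apply/eq_primes => p; rewrite !mem_primes /=; have [pp|//] := boolP (prime p).
have inN k : k.+1 %| N ^ 2 -> p %| k.+1 -> p \in primes N.
  move=> kN pk; rewrite mem_primes pp N0 /=.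
  by have := dvdn_trans pk kN; rewrite Euclid_dvdX// => /andP[].
by apply/idP/idP => /= pk;
  [rewrite -(eqlm p (inN l lN pk))|rewrite (eqlm p (inN m mN pk))].
Qed.

Lemma logn_prod (I : Type) (r : seq I) (F : I -> nat) p :
  (forall i, 0 < F i) ->
  logn p (\prod_(i <- r) F i) = \sum_(i <- r) logn p (F i).
Proof.
move=> F0; elim: r => [|i r ih]; first by rewrite !big_nil logn1.
by rewrite !big_cons lognM ?prodn_gt0// ih.
Qed.

Lemma even_logn_sqr n : 0 < n -> (forall p, prime p -> ~~ odd (logn p n)) ->
  exists N, n = N ^ 2.
Proof.
move=> n0 ev; exists (\prod_(p <- primes n) p ^ (logn p n)./2).
rewrite [LHS](prod_prime_decomp n0) prime_decompE big_map /= -[_ ^ 2]mulnn.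
rewrite -big_split /= big_seq [RHS]big_seq; apply: eq_bigr => p.
rewrite mem_primes => /andP[/ev/even_halfK + _].
by rewrite -expnD addnn => {1}<-.
Qed.

End Arithmetic.

(** * Expectation of bounded functions of independent variables *)

(** The bound holds everywhere, not just almost everywhere: the class is then closed under sums,
    products and composition, and all its members are integrable for a probability. *)
Definition bounded_measurable {d} {T : measurableType d} {R : realType}
    (f : T -> R) : Prop :=
  measurable_fun setT f /\ exists M, forall x, `|f x| <= M.

Section BoundedMeasurable.
Context {d : measure_display} {T : measurableType d} {R : realType}.
Implicit Types f g : T -> R.

Lemma bm_cst c : bounded_measurable (fun _ : T => c : R).
Proof. by split; [exact: measurable_cst|exists `|c|]. Qed.

Lemma bm_indic A : measurable A -> bounded_measurable (\1_A : T -> R).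
Proof.
move=> mA; split; first exact: measurable_indic.
by exists 1 => x; rewrite indicE; case: (_ \in _); rewrite ?normr1 ?normr0.
Qed.

Lemma bmD f g : bounded_measurable f -> bounded_measurable g ->
  bounded_measurable (fun x => f x + g x).
Proof.
move=> [mf [M fM]] [mg [N gN]]; split; first exact: measurable_funD.
by exists (M + N) => x; rewrite (le_trans (ler_normD _ _))// lerD.
Qed.

Lemma bmM f g : bounded_measurable f -> bounded_measurable g ->
  bounded_measurable (fun x => f x * g x).
Proof.
move=> [mf [M fM]] [mg [N gN]]; split; first exact: measurable_funM.
by exists (M * N) => x; rewrite normrM ler_pM.
Qed.

Lemma bmZ c f : bounded_measurable f -> bounded_measurable (fun x => c * f x).
Proof. by move=> bf; apply: bmM => //; exact: bm_cst. Qed.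

Lemma bmB f g : bounded_measurable f -> bounded_measurable g ->
  bounded_measurable (fun x => f x - g x).
Proof.
move=> bf bg; under eq_fun do rewrite -mulN1r; apply: bmD => //; exact: bmZ.
Qed.

Lemma bmX f n : bounded_measurable f -> bounded_measurable (fun x => f x ^+ n).
Proof.
move=> bf; elim: n => [|n ih]; first exact: bm_cst.
by under eq_fun do rewrite exprS; exact: bmM.
Qed.

Lemma bm_sum (I : Type) (s : seq I) (Q : pred I) (F : I -> T -> R) :
  (forall i, bounded_measurable (F i)) ->
  bounded_measurable (fun x => \sum_(i <- s | Q i) F i x).
Proof.
move=> bF; elim: s => [|i s ih].
  by under eq_fun do rewrite big_nil; exact: bm_cst.
under eq_fun do rewrite big_cons.
by case: (Q i) => //; exact: bmD.
Qed.

Lemma bm_prod (I : Type) (s : seq I) (Q : pred I) (F : I -> T -> R) :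
  (forall i, bounded_measurable (F i)) ->
  bounded_measurable (fun x => \prod_(i <- s | Q i) F i x).
Proof.
move=> bF; elim: s => [|i s ih].
  by under eq_fun do rewrite big_nil; exact: bm_cst.
under eq_fun do rewrite big_cons.
by case: (Q i) => //; exact: bmM.
Qed.

Lemma bm_comp (Y : T -> R) (f : R -> R) : measurable_fun setT Y ->
  bounded_measurable f -> bounded_measurable (fun x => f (Y x)).
Proof.
by move=> mY [mf [M fM]]; split; [exact: measurableT_comp|exists M].
Qed.

Variable P : probability T R.

Lemma bm_integrable f : bounded_measurable f -> P.-integrable setT (EFin \o f).
Proof.
move=> [mf [M fM]]; apply: measurable_bounded_integrable => //.
  by rewrite (le_lt_trans (probability_le1 P _)) ?ltry.
exists M; split; first exact: num_real.
by move=> N MN x _ /=; rewrite (le_trans (fM x)) ?ltW.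
Qed.

Lemma Rintegral_cst1 (c : R) : \int[P]_x c = c.
Proof.
rewrite Rintegral_cst// [X in fine X](_ : _ = 1%E); first by rewrite /= mulr1.
exact: probability_setT.
Qed.

Lemma norm_Rintegral_le f (M : R) : bounded_measurable f ->
  (forall x, `|f x| <= M) -> `|\int[P]_x f x| <= M.
Proof.
move=> bf fM; rewrite (le_trans (le_normr_Rintegral _ _)) //; first exact: bm_integrable.
rewrite -[leRHS]Rintegral_cst1.
apply: le_Rintegral => //; last exact/bm_integrable/bm_cst.
apply: bm_integrable; case: bf => mf [N fN]; split; first exact: measurableT_comp.
by exists N => x; rewrite normr_id.
Qed.

Lemma bm_RintegralD f g : bounded_measurable f -> bounded_measurable g ->
  \int[P]_x (f x + g x) = \int[P]_x f x + \int[P]_x g x.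
Proof. by move=> bf bg; apply: RintegralD => //; exact: bm_integrable. Qed.

Lemma bm_RintegralB f g : bounded_measurable f -> bounded_measurable g ->
  \int[P]_x (f x - g x) = \int[P]_x f x - \int[P]_x g x.
Proof. by move=> bf bg; apply: RintegralB => //; exact: bm_integrable. Qed.

Lemma bm_RintegralZ c f : bounded_measurable f ->
  \int[P]_x (c * f x) = c * \int[P]_x f x.
Proof. by move=> bf; apply: RintegralZl => //; exact: bm_integrable. Qed.

Lemma bm_Rintegral_sum (I : Type) (s : seq I) (F : I -> T -> R) :
  (forall i, bounded_measurable (F i)) ->
  \int[P]_x (\sum_(i <- s) F i x) = \sum_(i <- s) \int[P]_x F i x.
Proof.
move=> bF; elim: s => [|i s ih].
  under eq_Rintegral do rewrite big_nil.
  by rewrite Rintegral_cst1 big_nil.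
under eq_Rintegral do rewrite big_cons.
by rewrite bm_RintegralD// ?big_cons ?ih//; exact: bm_sum.
Qed.

Lemma Rintegral_indicE A : measurable A -> \int[P]_x (\1_A x) = fine (P A).
Proof. by move=> mA; rewrite /Rintegral integral_indic// setIT. Qed.

End BoundedMeasurable.

(* The number of [j < N] with [j + 1 <= x] is [min N (floor x)]. *)
Lemma count_le_floor (R : realType) (N : nat) (x : R) : 0 <= x <= N%:R ->
  0 <= x - \sum_(j < N) (j.+1%:R <= x)%R%:R <= 1.
Proof.
move=> /andP[x0 xN].
(* Stated so that induction on [N] can drop the bound [x <= N]: either the count is within 1 of [x],
   or it is saturated. *)
suff : \sum_(j < N) (j.+1%:R <= x)%R%:R <= x /\
   (x <= \sum_(j < N) (j.+1%:R <= x)%R%:R + 1 \/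
    \sum_(j < N) (j.+1%:R <= x)%R%:R = N%:R :> R).
  by move=> [? [?|?]]; apply/andP; split; lra.
elim: N {xN} => [|N [ih1 ih2]]; first by rewrite !big_ord0; split => //; right.
rewrite big_ord_recr /=; set S := \sum_(_ < _) _ in ih1 ih2 *.
have SN : S <= N%:R.
  rewrite -[leRHS]mulr1 mulr_natl -[X in _ *+ X]card_ord -sumr_const.
  by apply: ler_sum => j _; rewrite lern1 leq_b1.
rewrite -natr1; case: (leP (N%:R + 1) x) => /= h.
  case: ih2 => ih2; first by split; [lra|left; lra].
  by split; [lra|right; lra].
by rewrite addr0; split => //; left; case: ih2 => ih2 //; lra.
Qed.

(** * From indicators to bounded functions: symmetry and independence *)

Section Independence.
Context {d : measure_display} {T : measurableType d} {R : realType}.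
Variable P : probability T R.

Section IndicatorExtension.
Variables (Y Y' W W' : T -> R).
Hypotheses (mY : measurable_fun setT Y) (mY' : measurable_fun setT Y').
Hypotheses (bW : bounded_measurable W) (bW' : bounded_measurable W').
Hypothesis indic_eq : forall A : set R, measurable A ->
  \int[P]_x (\1_A (Y x) * W x) = \int[P]_x (\1_A (Y' x) * W' x).

(* For [0 <= f <= 1] this combination of indicators of level sets is within
   [1 / (N + 1)] of [f] uniformly. *)
Let approx (f : R -> R) N y : R :=
  N.+1%:R^-1 * \sum_(j < N.+1) \1_[set z | j.+1%:R <= N.+1%:R * f z] y.

Let mlevel (f : R -> R) N j : measurable_fun setT f ->
  measurable [set z : R | j%:R <= N%:R * f z].
Proof.
move=> mf; rewrite -[X in measurable X]setTI.
have -> : [set z : R | j%:R <= N%:R * f z] =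
          (fun z => N%:R * f z) @^-1` `[j%:R, +oo[.
  by apply/seteqP; split => z /=; rewrite in_itv /= andbT.
have mg : measurable_fun setT (fun z : R => N%:R * f z) by exact: measurable_funM.
by apply: mg.
Qed.

Let approx_err (f : R -> R) N y : 0 <= f y <= 1 ->
  `|f y - approx f N y| <= N.+1%:R^-1.
Proof.
move=> /andP[f0 f1]; have N0 : (0 : R) < N.+1%:R by [].
have Nf : 0 <= N.+1%:R * f y <= N.+1%:R by rewrite mulr_ge0//= ler_piMr.
have /andP[h0 h1] := @count_le_floor R N.+1 (N.+1%:R * f y) Nf.
have -> : f y - approx f N y = N.+1%:R^-1 *
    (N.+1%:R * f y - \sum_(j < N.+1) (j.+1%:R <= N.+1%:R * f y)%R%:R).
  rewrite mulrBr mulKf ?gt_eqF//; congr (_ - _ * _).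
  by apply: eq_bigr => j _; rewrite indicE mem_setE.
by rewrite normrM !ger0_norm ?invr_ge0// ler_piMr ?invr_ge0.
Qed.

Let bm_approx (f : R -> R) N : measurable_fun setT f -> bounded_measurable (approx f N).
Proof. move=> mf; apply: bmZ; apply: bm_sum => j; apply: bm_indic; exact: mlevel. Qed.

Let approx_eq (f : R -> R) N : measurable_fun setT f ->
  \int[P]_x (approx f N (Y x) * W x) = \int[P]_x (approx f N (Y' x) * W' x).
Proof.
move=> mf.
have E Z V : measurable_fun setT Z -> bounded_measurable V ->
    \int[P]_x (approx f N (Z x) * V x) = N.+1%:R^-1 * \sum_(j < N.+1)
      \int[P]_x (\1_[set z | j.+1%:R <= N.+1%:R * f z] (Z x) * V x).
  move=> mZ bV; have bj (j : 'I_N.+1) : bounded_measurable (fun x =>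
      \1_[set z | j.+1%:R <= N.+1%:R * f z] (Z x) * V x : R).
    by apply: bmM => //; apply: bm_comp => //; apply: bm_indic; exact: mlevel.
  rewrite -bm_Rintegral_sum// -bm_RintegralZ; last exact: bm_sum.
  by apply: eq_Rintegral => x _; rewrite /approx -mulrA -mulr_suml.
rewrite !E//; congr (_ * _); apply: eq_bigr => j _; by apply: indic_eq; exact: mlevel.
Qed.

Let unit_eq (f : R -> R) : measurable_fun setT f -> (forall y, 0 <= f y <= 1) ->
  \int[P]_x (f (Y x) * W x) = \int[P]_x (f (Y' x) * W' x).
Proof.
move=> mf f01; have bf : bounded_measurable f.
  by split => //; exists 1 => y; have /andP[f0 f1] := f01 y; rewrite ger0_norm.
have [_ [M WM]] := bW; have [_ [M' WM']] := bW'.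
(* Replacing [f] by [approx f N] costs at most [1 / (N + 1)] times a bound on the weight, on either
   side. *)
have err N Z V K : measurable_fun setT Z -> bounded_measurable V ->
    (forall x, `|V x| <= K) ->
    `|\int[P]_x (f (Z x) * V x) - \int[P]_x (approx f N (Z x) * V x)| <=
    N.+1%:R^-1 * K.
  move=> mZ bV VK; rewrite -bm_RintegralB; last 2 first.
  - by apply: bmM => //; exact: bm_comp.
  - by apply: bmM => //; apply: bm_comp => //; exact: bm_approx.
  apply: norm_Rintegral_le => [|x].
    apply: bmB; apply: bmM => //; apply: bm_comp => //; exact: bm_approx.
  by rewrite -mulrBl normrM ler_pM// approx_err.
apply/eqP; rewrite -subr_eq0 -normr_le0 leNgt; apply/negP.
set D := `| _ | => D0.
have MM : 0 <= M + M'.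
  by apply: addr_ge0;
    [exact: le_trans (WM point)|exact: le_trans (WM' point)].
have DN N : D <= N.+1%:R^-1 * (M + M').
  have := err N _ _ _ mY bW WM; have := err N _ _ _ mY' bW' WM'.
  rewrite approx_eq// mulrDr /D => e1 e2.
  by rewrite -(subrKA (\int[P]_x (approx f N (Y' x) * W' x)))
    (le_trans (ler_normD _ _))// lerD// distrC.
(* A positive [D] cannot stay below [(M + M') / (N + 1)] for every [N]. *)
have := DN (Num.bound ((M + M') / D)); rewrite leNgt => /negP; apply.
rewrite mulrC ltr_pdivrMr// mulrC -ltr_pdivrMr//.
apply: lt_le_trans (archi_boundP _) _; last by rewrite ler_nat.
by rewrite divr_ge0// ltW.
Qed.

(** An affine change brings [f] into the unit interval. The lemma serves twice: for symmetry, with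
    [Y' = - Y] and weights 1, and for independence, with the other factors as [W] and a constant as
    [W']. *)
Lemma Rintegral_indic_ext (f : R -> R) : bounded_measurable f ->
  \int[P]_x (f (Y x) * W x) = \int[P]_x (f (Y' x) * W' x).
Proof.
(* The added 1 makes [M] positive even when [f] vanishes, so dividing by [2 * M] is legitimate. *)
move=> [mf [K fK]]; pose M := K + 1.
have fM y : - M <= f y <= M.
  by rewrite -ler_norml (le_trans (fK y))// lerDl.
have M0 : 0 < M by have := le_trans (normr_ge0 _) (fK 0); rewrite /M; lra.
pose h y := (f y + M) / (2 * M).
have h01 y : 0 <= h y <= 1.
  have /andP[? ?] := fM y; rewrite /h divr_ge0 ?ler_pdivrMr /=; lra.
have mh : measurable_fun setT h.
  by apply: measurable_funM => //; exact: measurable_funD.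
have bh : bounded_measurable h.
  by split => //; exists 1 => y; have /andP[? ?] := h01 y; rewrite ger0_norm.
(* The constant shift is written with the indicator of [setT], so [indic_eq] covers it too. *)
have E Z V : measurable_fun setT Z -> bounded_measurable V ->
    \int[P]_x (f (Z x) * V x) =
    2 * M * \int[P]_x (h (Z x) * V x) - M * \int[P]_x (\1_setT (Z x) * V x).
  move=> mZ bV.
  have b1 : bounded_measurable (fun x => h (Z x) * V x).
    by apply: bmM => //; exact: bm_comp.
  have b2 : bounded_measurable (fun x => \1_setT (Z x) * V x : R).
    by apply: bmM => //; apply: bm_comp => //; exact: bm_indic.
  rewrite -!bm_RintegralZ// -bm_RintegralB; [|exact: bmZ..].
  apply: eq_Rintegral => x _; rewrite indicE in_setT mulr1n mul1r /h; field.
  by rewrite gt_eqF.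
by rewrite !E// indic_eq// unit_eq.
Qed.

End IndicatorExtension.

(** [X] and [- X] give the same integral of [f], which oddness makes equal to its own negative. *)
Lemma symmetric_odd_Rintegral (X : {RV P >-> R}) (f : R -> R) :
  symmetric_RV X -> bounded_measurable f -> (forall x, f (- x) = - f x) ->
  \int[P]_w f (X w) = 0.
Proof.
move=> sX bf fN.
have mX : measurable_fun setT X by [].
have mNX : measurable_fun setT (fun w => - X w) by exact: measurableT_comp.
have E A Z : measurable A -> measurable_fun setT Z ->
    \int[P]_x (\1_A (Z x) * cst 1 x) = fine (P (Z @^-1` A)).
  move=> mA mZ; rewrite -Rintegral_indicE; last first.
    by rewrite -[X in measurable X]setTI; exact: mZ.
  by apply: eq_Rintegral => x _; rewrite mulr1.
have h A : measurable A ->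
   \int[P]_x (\1_A (X x) * cst 1 x) = \int[P]_x (\1_A (- X x) * cst 1 x).
  by move=> mA; rewrite !E//; congr fine; exact: sX.
have := Rintegral_indic_ext mX mNX (bm_cst 1) (bm_cst 1) h bf.
under eq_Rintegral do rewrite mulr1.
under [in X in _ = X -> _]eq_Rintegral do rewrite mulr1 fN -mulN1r.
by rewrite bm_RintegralZ; [lra|exact: bm_comp].
Qed.

Lemma Rintegral_prod_indep (I : choiceType) (D : set I) (X : I -> {RV P >-> R})
    (s : seq I) (g : I -> R -> R) :
  mutually_independent D X -> uniq s -> (forall i, i \in s -> D i) ->
  (forall i, bounded_measurable (g i)) ->
  \int[P]_w (\prod_(i <- s) g i (X i w)) =
  \prod_(i <- s) \int[P]_w g i (X i w).
Proof.
move=> indX us sD.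
(* Induction on a list [t] of indices where [g] is arbitrary, the others in [s] carrying indicators.
   For empty [t] this is independence itself; taking [t = s] gives the claim. *)
suff H : forall (t : seq I) g, (forall i, bounded_measurable (g i)) ->
    (forall i, i \in s -> i \notin t ->
      exists2 A : set R, measurable A & g i = \1_A) ->
    \int[P]_w (\prod_(i <- s) g i (X i w)) =
    \prod_(i <- s) \int[P]_w g i (X i w).
  by move=> bg; apply: (H s) => // i ->.
elim=> [|i t ih] {}g bg gt.
  (* Outside [s] the set is a dummy, [setT]. *)
  have /choice[A mA] : forall i, exists A : set R, measurable A /\
      (i \in s -> g i = \1_A).
    move=> i; have [si|//] := boolP (i \in s); last by exists setT.
    by have [A mA ->] := gt i si isT; exists A.
  have Js : perm_eq (enum_fset [fset x in s]%fset) s.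
    by apply: uniq_perm => // x; rewrite ?fset_uniq// in_fset.
  have mXA i : measurable (X i @^-1` A i).
    rewrite -[X in measurable X]setTI.
    have mX : measurable_fun setT (X i) by [].
    by apply: mX => //; exact: (mA i).1.
  have := indX [fset x in s]%fset A _ (fun i => (mA i).1).
  rewrite (perm_big _ Js) /= => PE.
  transitivity (fine (\prod_(i <- s) P (X i @^-1` A i))%E).
    rewrite -PE; last by move=> i /=; rewrite in_fset; exact: sD.
    rewrite -Rintegral_indicE; last first.
      by apply: fin_bigcap_measurable => // i _; exact: mXA.
    apply: eq_Rintegral => w _; rewrite indicE.
    have [|wN] := boolP (w \in _).
      rewrite in_setE => wA; rewrite big_seq big1// => i si.
      rewrite (mA i).2// indicE mem_set//.
      by apply: wA; rewrite /= in_fset.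
    apply/eqP; rewrite prodf_seq_eq0; apply/hasP; apply: contrapT => h.
    move/negP: wN; apply; rewrite in_setE => i /=; rewrite in_fset => si.
    apply: contrapT => nA; apply: h; exists i => //=.
    by rewrite (mA i).2// indicE memNset.
  rewrite -[RHS]/(fine _%:E); congr fine.
  rewrite big_seq [in RHS]big_seq; apply: (big_ind2 (fun x y => x = y%:E)) => //.
    by move=> _ x _ y -> ->.
  move=> i si; rewrite (_ : Rintegral _ _ _ = fine (P (X i @^-1` A i))).
    by rewrite fineK// fin_num_measure.
  rewrite -Rintegral_indicE//; apply: eq_Rintegral => w _.
  by rewrite (mA i).2.
have [si|nsi] := boolP (i \in s); last first.
  apply: ih => // j js jt; apply: gt => //; rewrite inE negb_or jt andbT.
  by apply: contraNneq nsi => <-.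
rewrite (bigD1_seq i)//=; under eq_Rintegral do rewrite (bigD1_seq i)//=.
have bW : bounded_measurable (fun w => \prod_(j <- s | j != i) g j (X j w)).
  by apply: bm_prod => j; exact: bm_comp.
set c := \prod_(j <- s | j != i) _.
(* Index [i] is freed by comparing the weight formed by the other factors with the constant product
   of their expectations. For indicators at [i] the two agree by induction, applied to [g']. *)
rewrite (@Rintegral_indic_ext _ (X i) _ (cst c))//; last 2 first.
- exact: bm_cst.
- move=> A mA; pose g' j := if j == i then \1_A else g j.
  have bg' j : bounded_measurable (g' j).
    by rewrite /g'; case: eqP => // _; exact: bm_indic.
  have gi j : j != i -> g' j = g j by rewrite /g' => /negbTE ->.
  have gii : g' i = \1_A by rewrite /g' eqxx.
  have := ih g' bg'; rewrite (bigD1_seq i)//= gii.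
  under eq_Rintegral do rewrite (bigD1_seq i)//= gii
    (eq_bigr (fun j => g j (X j _)) (fun j ji => congr1 (@^~ _) (gi j ji))).
  rewrite (eq_bigr (fun j => \int[P]_w (g j (X j w)))); last first.
    by move=> j ji; rewrite gi.
  move=> -> => [|j js jt]; last first.
    have [->|ji] := eqVneq j i; first by exists A.
    by rewrite gi//; apply: gt => //; rewrite inE negb_or ji.
  rewrite mulrC -bm_RintegralZ; last by apply: bm_comp => //; exact: bm_indic.
  by apply: eq_Rintegral => w _; rewrite mulrC.
rewrite mulrC -bm_RintegralZ; last exact: bm_comp.
by apply: eq_Rintegral => w _; rewrite mulrC.
Qed.

End Independence.

(** * Moments of the partial sums *)

(** Being odd and measurable, this cut-off preserves symmetry and independence; it turns almost sure
    bounds into bounds everywhere. *)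
Definition truncate {R : realType} (M : R) (x : R) : R := x * \1_(`[- M, M]) x.

Section Truncate.
Context {R : realType}.
Implicit Types M x : R.

Lemma truncate_id M x : `|x| <= M -> truncate M x = x.
Proof.
move=> xM; rewrite /truncate indicE mem_set ?mulr1//=.
by rewrite in_itv /= -ler_norml.
Qed.

Lemma truncateN M x : truncate M (- x) = - truncate M x.
Proof.
rewrite /truncate mulNr; congr (- (_ * _)); rewrite !indicE !mem_setE.
by rewrite !in_itv /= -!ler_norml normrN.
Qed.

Lemma norm_truncate_le M x : 0 <= M -> `|truncate M x| <= M.
Proof.
move=> M0; rewrite /truncate indicE mem_setE in_itv /= -ler_norml.
by have [xM|_] := leP `|x| M; rewrite ?mulr1// mulr0 normr0.
Qed.

Lemma measurable_truncate M : measurable_fun setT (truncate M).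
Proof. by apply: measurable_funM => //; exact: measurable_indic. Qed.

Lemma bm_truncate M : 0 <= M -> bounded_measurable (truncate M).
Proof.
move=> M0; split; first exact: measurable_truncate.
by exists M => x; exact: norm_truncate_le.
Qed.

End Truncate.

(** * Even moments for variables bounded everywhere *)

Section Moments.
Context {d : measure_display} {T : measurableType d} {R : realType}.
Variables (P : probability T R) (X : nat -> {RV P >-> R}) (M : nat).
Hypothesis X_indep : mutually_independent [set p : nat | prime p] X.
Hypothesis X_sym : forall p, prime p -> symmetric_RV (X p).
Hypothesis M_gt0 : (0 < M)%N.
Hypothesis X_le : forall p w, `|X p w| <= M%:R.

Lemma bm_X p : bounded_measurable (X p).
Proof. by split => //; exists M%:R. Qed.

Lemma bm_rademacher l : bounded_measurable (rademacher_mult X l).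
Proof.
rewrite /rademacher_mult; case: asboolP => _; last exact: bm_cst.
by apply: bm_prod => p; exact: bm_X.
Qed.

Lemma norm_rademacher_le l w :
  `|rademacher_mult X l w| <= M%:R ^+ size (primes l).
Proof.
rewrite /rademacher_mult; case: asboolP => _; last first.
  by rewrite normr0 exprn_ge0.
rewrite normr_prod.
have -> : M%:R ^+ size (primes l) = \prod_(p <- primes l) M%:R :> R.
  by rewrite big_const_seq count_predT -Monoid.iteropE.
by apply: ler_prod => p _; rewrite normr_ge0 X_le.
Qed.

Section Products.
Variables (I : finType) (l : I -> nat).
Hypothesis l_sqf : forall i, squarefree (l i).

Let L := (\prod_i l i)%N.

Let l_gt0 i : (0 < l i)%N. Proof. exact: squarefree_gt0. Qed.

Let dvdL i : (l i %| L)%N.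
Proof. by rewrite /L (bigD1 i)//= dvdn_mulr. Qed.

Let L_gt0 : (0 < L)%N. Proof. exact: prodn_gt0. Qed.

(** For squarefree [l i] the exponent [logn p (l i)] is 0 or 1, so every factor can be written over
    the common index set [primes L]; exponents then add up. *)
Lemma prod_rademacher w :
  \prod_i rademacher_mult X (l i) w = \prod_(p <- primes L) X p w ^+ logn p L.
Proof.
have E i : rademacher_mult X (l i) w = \prod_(p <- primes L) X p w ^+ logn p (l i).
  rewrite /rademacher_mult asboolT//.
  rewrite [RHS](bigID (fun p => p \in primes (l i)))/= [X in _ = _ * X]big1 ?mulr1; last first.
    by move=> p; rewrite -logn_gt0 lt0n negbK => /eqP ->.
  rewrite -[in RHS]big_filter.
  rewrite (perm_big [seq p <- primes L | p \in primes (l i)]).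
    rewrite big_seq [RHS]big_seq; apply: eq_bigr => p.
    rewrite mem_filter => /andP[pl pL].
    by rewrite squarefree_logn// ?pl ?expr1//; move: pl; rewrite mem_primes => /andP[].
  apply: uniq_perm; rewrite ?filter_uniq ?primes_uniq// => p.
  rewrite mem_filter; have [|//] := boolP (p \in primes (l i)).
  rewrite !mem_primes L_gt0 => /and3P[-> _ pl]; by rewrite (dvdn_trans pl (dvdL i)).
under eq_bigr do rewrite E.
rewrite exchange_big /=; apply: eq_bigr => p _.
by rewrite /L logn_prod// -expr_sum.
Qed.

(** A non-square [L] has a prime with odd exponent. Independence splits off the corresponding odd
    moment, which vanishes by symmetry. *)
Lemma Rintegral_prod_rademacher_eq0 : ~ (exists N, L = N ^ 2)%N ->
  \int[P]_w (\prod_i rademacher_mult X (l i) w) = 0.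
Proof.
move=> nsq; have [p [pp po]] : exists p, prime p /\ odd (logn p L).
  apply: contrapT => h; apply: nsq; apply: even_logn_sqr => // p pp.
  by apply/negP => po; apply: h; exists p.
under eq_Rintegral do rewrite prod_rademacher.
(* Powers are unbounded on the line; truncating at [M] makes them bounded without changing their
   values on [X q w]. *)
pose g q x : R := truncate M%:R x ^+ logn q L.
have bg q : bounded_measurable (g q) by apply: bmX; exact: bm_truncate.
have -> : \int[P]_w (\prod_(q <- primes L) X q w ^+ logn q L) =
    \int[P]_w (\prod_(q <- primes L) g q (X q w)).
  apply: eq_Rintegral => w _; apply: eq_bigr => q _.
  by rewrite /g truncate_id.
rewrite (Rintegral_prod_indep X_indep)// ?primes_uniq//; last first.
  by move=> q /=; rewrite mem_primes => /andP[].
apply/eqP; rewrite prodf_seq_eq0; apply/hasP; exists p.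
  by rewrite -logn_gt0; case: (logn p L) po.
apply/eqP; apply: symmetric_odd_Rintegral (X_sym pp) (bg p) _ => x.
by rewrite /g truncateN exprNn -signr_odd po expr1 mulN1r.
Qed.

(** Every prime of [l i] divides [N], so each factor is at most [M ^ size (primes N)], using
    [M >= 1]. *)
Lemma norm_Rintegral_prod_rademacher_le N : L = (N ^ 2)%N ->
  `|\int[P]_w (\prod_i rademacher_mult X (l i) w)| <=
  (M ^ (#|I| * size (primes N)))%:R.
Proof.
move=> LN; apply: norm_Rintegral_le => [|w].
  by apply: bm_prod => i; exact: bm_rademacher.
rewrite normr_prod mulnC expnM.
have -> : ((M ^ size (primes N)) ^ #|I|)%N%:R =
    \prod_(i : I) M%:R ^+ size (primes N) :> R.
  by rewrite prodr_const !natrX.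
apply: ler_prod => i _; rewrite normr_ge0 (le_trans (norm_rademacher_le _ _))//.
rewrite ler_weXn2l ?ler1n//; apply: uniq_leq_size; first exact: primes_uniq.
move=> p; rewrite -(primesX N (isT : 0 < 2)%N) -LN !mem_primes L_gt0.
by move=> /and3P[-> _ pl]; rewrite (dvdn_trans pl (dvdL i)).
Qed.

End Products.

(** The bound is spread over all candidate roots [N.+1 <= n ^ k], though one term suffices, so that
    summing over [f] can later be exchanged with summing over [N]. *)
Lemma moment_term_le k n (f : {ffun 'I_k.*2 -> 'I_n}) :
  `|\int[P]_w (\prod_j rademacher_mult X (f j).+1 w)| <=
  (\sum_(N < n ^ k) (f \in ffun_on
     [set l : 'I_n | `[<squarefree l.+1>] && (l.+1 %| N.+1 ^ 2)]%SET) *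
     M ^ (k.*2 * size (primes N.+1)))%N%:R.
Proof.
have [sqf|/existsNP[j nsqf]] := pselect (forall j, squarefree (f j).+1); last first.
  rewrite [X in `|X|](_ : _ = 0) ?normr0//.
  under eq_Rintegral => w _.
    rewrite (bigD1 j)//= {1}/rademacher_mult asboolF// mul0r; over.
  exact: Rintegral_cst1.
have [[N LN]|nN] := pselect (exists N, \prod_j (f j).+1 = N ^ 2)%N; last first.
  by rewrite Rintegral_prod_rademacher_eq0// normr0.
have N0 : (0 < N)%N.
  have : (0 < \prod_j (f j).+1)%N by exact: prodn_gt0.
  by rewrite LN expn_gt0 orbF.
(* [N ^ 2] is a product of [2k] factors at most [n], whence [N <= n ^ k]; the predecessor matches
   the shifted index of the sum. *)
have Nn : (N.-1 < n ^ k)%N.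
  rewrite prednK// -(@leq_exp2r _ _ 2)// -LN -expnM muln2.
  rewrite -[X in (_ <= _ ^ X)%N]card_ord -prod_nat_const.
  by apply: leq_prod => j _.
apply: le_trans (norm_Rintegral_prod_rademacher_le _ LN) _ => //.
rewrite ler_nat (bigD1 (Ordinal Nn))//= prednK// card_ord.
rewrite (_ : _ \in _) ?mul1n ?leq_addr//.
apply/ffun_onP => j; rewrite inE asboolT//= -LN.
by rewrite (bigD1 j)//= dvdn_mulr.
Qed.

Lemma partial_sum_moment_le k : (0 < k)%N -> exists C : nat, forall n,
  \int[P]_w (partial_sum X n w ^+ k.*2) <= (C * n ^ k.+1)%N%:R.
Proof.
(* For fixed [N] there are at most [2 ^ (2k omega(N))] tuples of size at most [M ^ (2k omega(N))]
   each. [expn_omega_le_root] with [A = (2M) ^ 2k] bounds this by [K ^ K * n], and [N] takes [n ^ k]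
   values. *)
move=> k0; pose K := (((2 * M) ^ k.*2) ^ k)%N; exists (K ^ K)%N => n.
have E w : partial_sum X n w ^+ k.*2 = \sum_(f : {ffun 'I_k.*2 -> 'I_n})
    \prod_j rademacher_mult X (f j).+1 w.
  rewrite -(bigA_distr_bigA (fun (_ : 'I_k.*2) (l : 'I_n) => rademacher_mult X l.+1 w)).
  by rewrite prodr_const card_ord /partial_sum big_add1 big_mkord.
under eq_Rintegral do rewrite E.
rewrite bm_Rintegral_sum; last first.
  by move=> f; apply: bm_prod => j; exact: bm_rademacher.
apply: le_trans (ler_norm _) _; apply: le_trans (ler_norm_sum _ _ _) _.
apply: le_trans (ler_sum _ (fun f _ => moment_term_le f)) _.
rewrite -natr_sum ler_nat exchange_big /=.
have -> : (K ^ K * n ^ k.+1 = \sum_(N < n ^ k) K ^ K * n)%N.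
  by rewrite sum_nat_const card_ord expnSr mulnCA.
apply: leq_sum => N _; rewrite -big_distrl /= -big_mkcond /= sum1_card.
rewrite card_ffun_on card_ord.
have N0 : (0 < N.+1 <= n ^ k)%N := ltn_ord N.
apply: leq_trans (expn_omega_le_root ((2 * M) ^ k.*2) k0 N0).
rewrite -(expnM (2 * M)) expnMn leq_mul// mulnC expnM.
by rewrite leq_exp2r ?double_gt0// card_squarefree_dvd_sqr.
Qed.

End Moments.

(** * From moments to an almost sure bound *)

(** Comparison with a telescoping sum: [1 / m ^ 3 <= 2 / (m (m + 1))] for [m >= 1], because
    [m + 1 <= 2 m ^ 2]. *)
Lemma nneseries_inv_cube_le (R : realType) (c : R) : 0 <= c ->
  (\sum_(n <oo) (c / n.+1%:R ^+ 3)%:E <= (2 * c)%:E)%E.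
Proof.
move=> c0; apply: lime_le.
  by apply: is_cvg_nneseries => n _ _; rewrite lee_fin divr_ge0// exprn_ge0.
apply: nearW => N; rewrite sumEFin lee_fin.
suff : \sum_(0 <= n < N) c / n.+1%:R ^+ 3 <= 2 * c * (1 - N.+1%:R^-1).
  by move=> h; apply: le_trans h _; rewrite ler_piMr ?mulr_ge0// lerBlDr lerDl.
elim: N => [|N ih]; first by rewrite big_geq// invr1 subrr mulr0.
rewrite big_nat_recr//= -lerBrDr; apply: le_trans ih _.
rewrite lerBrDr -lerBrDl -mulrBr -mulrA mulrCA ler_wpM2l//.
set m : R := N.+1%:R; have m1 : 1 <= m by rewrite ler1n.
have -> : N.+2%:R = m + 1 :> R by rewrite -natr1.
have -> : 2 * (1 - (m + 1)^-1 - (1 - m^-1)) = 2 / (m * (m + 1)).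
  by field; apply/andP; split; apply/eqP; lra.
rewrite ler_pdivlMr; last by apply: mulr_gt0; lra.
rewrite mulrC ler_pdivrMr; last by apply: exprn_gt0; lra.
have : m + 1 <= 2 * m ^+ 2 by nra.
by move=> h; rewrite exprS mulrCA; apply: ler_wpM2l => //; lra.
Qed.

Section Domination.
Context {d : measure_display} {T : measurableType d} {R : realType}.
Variable P : probability T R.

(* Summing the normalised moments over all [n] dominates the supremum; the
   exponent [k + 1] leaves a convergent series since [2 * k * eps >= 4]. *)
Lemma dominating_RV (S : nat -> T -> R) (k : nat) (C eps : R) :
  (0 < k)%N -> 2 <= k%:R * eps -> 0 <= C ->
  (forall n, bounded_measurable (S n)) ->
  (forall n, \int[P]_w (S n w ^+ k.*2) <= C * n%:R ^+ k.+1) ->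
  exists B : {RV P >-> R},
    [/\ (B : T -> R) \in Lfun P (k.*2%:R)%:E, forall w, 0 <= B w &
    {ae P, forall w, forall n, (0 < n)%N ->
      `|S n w| <= B w * n%:R `^ (1 / 2 + eps)}].
Proof.
move=> k0 keps C0 bS mom.
have k2 : (0 : R) < k.*2%:R by rewrite ltr0n double_gt0.
pose a n : R := n.+1%:R `^ (k.*2%:R * (1 / 2 + eps)).
have a0 n : 0 < a n by rewrite powR_gt0.
pose u n w := (a n)^-1 * S n.+1 w ^+ k.*2.
have u0 n w : 0 <= u n w.
  apply: mulr_ge0; first by rewrite invr_ge0 ltW.
  by rewrite -mul2n exprM exprn_ge0// sqr_ge0.
have bu n : bounded_measurable (u n) by apply: bmZ; exact: bmX.
have mu n : measurable_fun setT (fun w => (u n w)%:E).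
  by apply/measurable_EFinP; case: (bu n).
(* The weight has exponent [2k (1/2 + eps) >= k + 4], which beats the moment's [k + 1] by at least
   3. *)
have iu n : (\int[P]_w (u n w)%:E <= (C / n.+1%:R ^+ 3)%:E)%E.
  rewrite -[leLHS]fineK; last by apply: integrable_fin_num => //; exact: bm_integrable.
  rewrite lee_fin -/(Rintegral P setT (u n)) bm_RintegralZ; last exact: bmX.
  rewrite ler_pdivrMl//; apply: le_trans (mom n.+1) _.
  rewrite mulrCA ler_wpM2l// ler_pdivlMr ?exprn_gt0// -exprD.
  rewrite -powR_mulrn// ler_powR ?ler1n//.
  by rewrite natrD -natr1 -muln2 natrM; nra.
pose Z w := (\sum_(n <oo) (u n w)%:E)%E.
have Z0 w : (0 <= Z w)%E by apply: nneseries_ge0 => n _ _; rewrite lee_fin.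
have mZ : measurable_fun setT Z.
  by apply: ge0_emeasurable_sum => // n w _ _; rewrite lee_fin.
have iZ : (\int[P]_w Z w < +oo)%E.
  rewrite integral_nneseries//; last by move=> n w _; rewrite lee_fin.
  apply: le_lt_trans (ltry (2 * C)); apply: le_trans (nneseries_inv_cube_le C0).
  by apply: lee_nneseries => // n _ _; apply: integral_ge0 => w _; rewrite lee_fin.
have Zfin : {ae P, forall w, Z w \is a fin_num}.
  have : P.-integrable setT Z.
    apply/integrableP; split => //.
    by under eq_integral do rewrite gee0_abs//.
  by move=> /(integrable_ae measurableT); apply: filterS => w; exact.
(* [fine] sends an infinite [Z w] to 0, which happens only on a null set; the pointwise bound is
   claimed almost everywhere. *)
pose b w : R := fine (Z w) `^ (k.*2%:R)^-1.
have mfZ : measurable_fun setT (fun w => fine (Z w)) by exact: measurableT_comp.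
have mb : measurable_fun setT b.
  by apply: (measurableT_comp (measurable_powR (k.*2%:R)^-1)).
exists (mfun_Sub (mem_set mb : b \in mfun)); split => /=; last 2 first.
- by move=> w; exact: powR_ge0.
- apply: filterS Zfin => w Zw [//|n] _.
  (* One nonnegative term is at most the whole series; the [2k]-th root of this gives the bound on
     [S]. *)
  have uZ : u n w <= fine (Z w).
    rewrite -lee_fin fineK//; apply: le_trans (nneseries_lim_ge n.+1 _).
      by rewrite big_nat_recr//= leeDr// sume_ge0// => i _; rewrite lee_fin.
    by move=> i _ _; rewrite lee_fin.
  have SZ : `|S n.+1 w| ^+ k.*2 <= fine (Z w) * a n.
    rewrite -normrX ger0_norm; last by rewrite -mul2n exprM exprn_ge0// sqr_ge0.
    by rewrite -ler_pdivrMr// mulrC.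
  have -> : `|S n.+1 w| = (`|S n.+1 w| ^+ k.*2) `^ (k.*2%:R)^-1.
    by rewrite -powR_mulrn// -powRrM divff ?gt_eqF// powRr1.
  have -> : b w * n.+1%:R `^ (1 / 2 + eps) =
      (fine (Z w) * a n) `^ (k.*2%:R)^-1.
    rewrite [RHS]powRM; [|exact: fine_ge0|exact: ltW].
    rewrite /a -powRrM; congr (_ * _ `^ _).
    by field; rewrite gt_eqF.
  apply: ge0_ler_powR => //; rewrite ?invr_ge0 ?(ltW k2)// nnegrE ?exprn_ge0//.
  by rewrite mulr_ge0 ?fine_ge0// ltW.
(* Membership in [Lfun]: the [2k]-th power of [b] is [fine (Z w)], at most [Z w], whose integral is
   finite. *)
rewrite inE; apply/andP; split; first by rewrite inE.
rewrite inE /= /finite_norm unlock /Lnorm /= poweR_lty//.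
apply: le_lt_trans iZ; apply: ge0_le_integral => //.
- apply/measurable_EFinP.
  apply: (measurableT_comp (measurable_powR (k.*2%:R))).
  exact: measurableT_comp.
move=> w _; rewrite ger0_norm ?powR_ge0// /b -powRrM mulVf ?gt_eqF//.
rewrite powRr1 ?fine_ge0//.
by case: (Z w) (Z0 w) => //= r _; rewrite leey.
Qed.

End Domination.

(** * Reduction to variables bounded everywhere *)

Section Truncation.
Context {d : measure_display} {T : measurableType d} {R : realType}.
Variable P : probability T R.

(** Each norm bounds its variable off a null set, and countably many null sets have a null union. *)
Lemma ae_bounded_family (X : nat -> {RV P >-> R}) (D : set nat) :
  (ereal_sup [set 'N[P]_(+oo)[EFin \o X p] | p in D] < +oo)%E ->
  exists2 M : nat, (0 < M)%N &
    {ae P, forall w, forall p, D p -> `|X p w| <= M%:R}.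
Proof.
set s := ereal_sup _ => soo.
have [r sr] : exists r : R, (s <= r%:E)%E.
  (* The supremum of an empty family is [-oo], so 0 serves as bound there. *)
  by case: s soo => [r _|//|_]; [exists r|exists 0; rewrite leNye].
exists (Num.bound r).+1 => //; apply: ae_foralln => p.
have [Dp|nDp] := pselect (D p); last by apply: aeW.
have : ('N[P]_(+oo)[EFin \o X p] <= r%:E)%E.
  by apply: le_trans sr; apply: ereal_sup_ubound; exists p.
rewrite unlock /Lnorm.
have -> : (0 < P setT)%E.
  by rewrite [X in (_ < X)%E](_ : _ = 1%E) ?lte01//; exact: probability_setT.
move=> /ess_supP; apply: filterS => w /=; rewrite lee_fin => h _.
apply: le_trans h _; apply: le_trans (ltW (unstable.ltr_bound _)) _.
by rewrite ler_nat.
Qed.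

Definition truncate_RV (M : R) (X : {RV P >-> R}) : {RV P >-> R} :=
  mfun_Sub (mem_set (measurableT_comp (measurable_truncate M)
    (measurable_funPT X)) : truncate M \o X \in mfun).

Lemma truncate_RV_indep (M : R) (I : choiceType) (D : set I)
    (X : I -> {RV P >-> R}) : mutually_independent D X ->
  mutually_independent D (fun i => truncate_RV M (X i)).
Proof.
move=> indX J A JD mA; apply: (indX J (fun i => truncate M @^-1` A i)) => // i.
by rewrite -[X in measurable X]setTI; exact: measurable_truncate.
Qed.

Lemma truncate_RV_sym (M : R) (X : {RV P >-> R}) :
  symmetric_RV X -> symmetric_RV (truncate_RV M X).
Proof.
move=> sX A mA; have /= := sX (truncate M @^-1` A).
rewrite /pushforward => -> //; last first.
  by rewrite -[X in measurable X]setTI; exact: measurable_truncate.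
by congr (P _); apply/seteqP; split => w /=; rewrite truncateN.
Qed.

Lemma eq_partial_sum (X Y : nat -> {RV P >-> R}) n w :
  (forall p, prime p -> X p w = Y p w) -> partial_sum X n w = partial_sum Y n w.
Proof.
move=> XY; apply: eq_bigr => l _; rewrite /rademacher_mult; case: asboolP => // _.
rewrite big_seq [RHS]big_seq; apply: eq_bigr => p.
by rewrite mem_primes => /andP[/XY].
Qed.

End Truncation.

Theorem corollary2p5 (d : measure_display) (T : measurableType d)
    (R : realType) (P : probability T R) (X : nat -> {RV P >-> R})
    (X_indep : mutually_independent [set p : nat | prime p] X)
    (X_sym : forall p : nat, prime p -> symmetric_RV (X p))
    (X_nonconst : forall p : nat, prime p -> ~ constant_RV (X p))
    (X_bounded : (ereal_sup [set 'N[P]_(+oo)[EFin \o X p]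
                               | p in [set p : nat | prime p]] < +oo)%E)
    (eps : R) (eps_gt0 : 0 < eps) :
  exists B : {RV P >-> R},
    (B : T -> R) \in Lfun P ((Num.floor (1 / (2 * eps)) + 1)%:~R)%:E /\
    forall n : nat,
      {ae P, forall w, `|partial_sum X n w| <= B w * n%:R `^ (1 / 2 + eps)}.
Proof.
have [M M0 XM] := ae_bounded_family X_bounded.
pose Y p := truncate_RV M%:R (X p).
have Y_le p w : `|Y p w| <= M%:R by exact: norm_truncate_le.
have Y_indep := truncate_RV_indep M%:R X_indep.
have Y_sym p : prime p -> symmetric_RV (Y p).
  by move=> /X_sym; exact: truncate_RV_sym.
set m : R := (Num.floor _ + 1)%:~R.
have m1 : 1 <= m.
  rewrite ler1z lerDr floor_ge0; apply: divr_ge0 => //; lra.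
(* The first summand ensures [m <= k], hence [m <= 2k]; the second ensures [k * eps >= 2], the
   convergence condition. *)
pose k := (Num.bound m + Num.bound (2 / eps)).+1.
have mk : m <= k%:R.
  by rewrite (le_trans (ltW (unstable.ltr_bound m)))// ler_nat /k -addnS leq_addr.
have keps : 2 <= k%:R * eps.
  rewrite -ler_pdivrMr// (le_trans (ltW (unstable.ltr_bound _)))// ler_nat.
  by rewrite /k -addSn leq_addl.
have k0 : (0 < k)%N by [].
have [C mom] := partial_sum_moment_le Y_indep Y_sym M0 Y_le k0.
have bS n : bounded_measurable (partial_sum Y n).
  by apply: bm_sum => l; exact: bm_rademacher Y_le l.
have [||B [LB B0 SB]] := dominating_RV k0 keps _ bS (C := C%:R) (P := P).
- by [].
- by move=> n; rewrite -natrX -natrM.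
exists B; split.
  have mk2 : m <= k.*2%:R by rewrite (le_trans mk)// ler_nat -addnn leq_addr.
  (* On a space of finite measure the larger exponent [2k] gives the smaller space, so [B] is also
     in [L^m]. *)
  apply: (@Lfun_subset _ _ _ _ m%:E (k.*2%:R)%:E _ _ _ _ B LB).
  - by rewrite lee_fin.
  - by rewrite lee_fin (le_trans m1).
  - exact: fin_num_measure.
  - by rewrite lee_fin.
(* Almost surely truncation changes no [X p] at a prime, so the bound for [Y] passes to [X]. *)
move=> n; apply: filterS2 XM SB => w XMw SBw.
rewrite (@eq_partial_sum _ _ _ _ X Y) => [|p pp]; last first.
  by rewrite /= truncate_id ?XMw.
(* The dominating bound covers positive [n] only; for [n = 0] the partial sum is empty. *)
have [->|n0] := posnP n; last exact: SBw.
by rewrite /partial_sum big_geq// normr0 mulr_ge0// powR_ge0.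
Qed.
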